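(* Let $q\in(0,1)$, let $j_1,j_2\in\{0,\tfrac12,1,\tfrac32,\dots\}$, $j\in\{|j_1-j_2|,|j_1-j_2|+1,\dots,j_1+j_2\}$, $m_i\in\{-j_i,-j_i+1,\dots,j_i\}$ for $i=1,2$, and assume $m:=m_1+m_2$ satisfies $-j\le m\le j$. Then the Clebsch-Gordan coefficients of $su_q(2)$ satisfy $$\langle j_1m_1,j_2m_2|jm\rangle_q=\langle j_2\,{-m_2},j_1\,{-m_1}|j\,{-m}\rangle_q=(-1)^{j_1+j_2-j}\,\langle j_1\,{-m_1},j_2\,{-m_2}|j\,{-m}\rangle_{1/q}.$$
   Context: Notation. For real $q>0$, $q\ne1$: $[x]_q=\frac{q^x-q^{-x}}{q-q^{-1}}$ for $x\in\mathbb R$; $[0]_q!=1$ and $[n]_q!=[1]_q[2]_q\cdots[n]_q$ for $n\in\mathbb N$. Representations. For $j\in\{0,\frac12,1,\dots\}$, $D^j$ is the complex inner product space with orthonormal basis $|jm\rangle$, $m=-j,-j+1,\dots,j$, and operators $$J_0|jm\rangle=m|jm\rangle,\quad J_-|jm\rangle=\sqrt{[j+m]_q[j-m+1]_q}\,|j\,m-1\rangle,\quad J_+|jm\rangle=\sqrt{[j-m]_q[j+m+1]_q}\,|j\,m+1\rangle,$$ and $q^{aJ_0}|jm\rangle=q^{am}|jm\rangle$. On $D^{j_1}\otimes D^{j_2}$ (orthonormal basis $|j_1m_1\rangle|j_2m_2\rangle$) put $J_0(12)=J_0\otimes1+1\otimes J_0$ and $J_\pm(12)=J_\pm\otimes q^{J_0}+q^{-J_0}\otimes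 J_\pm$. Clebsch-Gordan coefficients. For $j\in\{|j_1-j_2|,\dots,j_1+j_2\}$ and $m\in\{-j,\dots,j\}$ let $$P^j_{mj}=\sqrt{\frac{[j+m]_q!}{[2j]_q!\,[j-m]_q!}}\sum_{r\ge0}\frac{(-1)^r[2j+1]_q!}{[r]_q!\,[2j+r+1]_q!}\,J_-(12)^{\,r+j-m}J_+(12)^{\,r}$$ (a finite sum, since $J_+(12)$ is nilpotent), and let $|j_1,j_2:jm\rangle$ be the unit vector $P^j_{mj}|j_1j_1\rangle|j_2\,j-j_1\rangle/\|P^j_{mj}|j_1j_1\rangle|j_2\,j-j_1\rangle\|$. For $m=m_1+m_2$, $\langle j_1m_1,j_2m_2|jm\rangle_q$ denotes the coefficient of $|j_1m_1\rangle|j_2m_2\rangle$ in $|j_1,j_2:jm\rangle$. The subscript indicates the base; $\langle\cdots\rangle_{1/q}$ is the same quantity with $q$ replaced by $1/q$ everywhere in the construction (in particular in the operators $J_\pm(12)$). *)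

(* Defs.v *)
From mathcomp Require Import all_boot all_order all_algebra.
From mathcomp Require Import reals exp.
From mathcomp Require Import complex mxtens.

Set Implicit Arguments.
Unset Strict Implicit.
Unset Printing Implicit Defensive.

Import Order.TTheory GRing.Theory Num.Theory.

Local Open Scope ring_scope.
Local Open Scope complex_scope.

Section CG.
Context {R : realType}.
Implicit Types q a j m x : R.

Definition qnum q x : R := (q `^ x - q `^ (- x)) / (q - q^-1).

Definition qfact q (n : nat) : R := \prod_(1 <= k < n.+1) qnum q k%:R.

(* Spins and magnetic numbers are real numbers; [Num.truncn] turns those
   combinations of them that are natural numbers into elements of [nat]. *)
Definition qfactr q x : R := qfact q (Num.truncn x).

Definition is_spin j : Prop := exists n : nat, j = n%:R / 2.

(* x belongs to {a, a + 1, ..., b} *)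
Definition in_steps a b x : Prop := (exists k : nat, x = a + k%:R) /\ x <= b.

(* D^j is 'cV[R[i]]_(dim j); the basis is listed by increasing m. *)
Definition dim j : nat := (Num.truncn (2 * j)).+1.

Definition mag j (i : 'I_(dim j)) : R := (i : nat)%:R - j.

(* The basis vector |j m>, or 0 if m is not one of -j, ..., j. *)
Definition ket j m : 'cV[R[i]]_(dim j) := \col_i (mag i == m)%:R.

(* Column k of an operator is the image of the k-th basis vector. *)
Definition Jminus q j : 'M[R[i]]_(dim j) :=
  \matrix_(i, k) ((Num.sqrt (qnum q (j + mag k) * qnum q (j - mag k + 1)))%:C
                  * ket j (mag k - 1) i 0).

Definition Jplus q j : 'M[R[i]]_(dim j) :=
  \matrix_(i, k) ((Num.sqrt (qnum q (j - mag k) * qnum q (j + mag k + 1)))%:C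
                  * ket j (mag k + 1) i 0).

(* q^{a J_0} *)
Definition qJ0 q a j : 'M[R[i]]_(dim j) :=
  diag_mx (\row_k (q `^ (a * mag k))%:C).

Definition Jminus12 q j1 j2 : 'M[R[i]]_(dim j1 * dim j2) :=
  Jminus q j1 *t qJ0 q 1 j2 + qJ0 q (- 1) j1 *t Jminus q j2.

Definition Jplus12 q j1 j2 : 'M[R[i]]_(dim j1 * dim j2) :=
  Jplus q j1 *t qJ0 q 1 j2 + qJ0 q (- 1) j1 *t Jplus q j2.

Definition ket12 j1 m1 j2 m2 : 'cV[R[i]]_(dim j1 * dim j2) :=
  ket j1 m1 *t ket j2 m2.

(* The sum over all r >= 0 stops before the dimension of the tensor product,
   from where on J_+(12)^r = 0: see [Jplus12_nilpotent] below. *)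
Definition proj q j1 j2 j m : 'M[R[i]]_(dim j1 * dim j2) :=
  (Num.sqrt (qfactr q (j + m) / (qfactr q (2 * j) * qfactr q (j - m))))%:C *:
  \sum_(0 <= r < dim j1 * dim j2)
    ((- 1) ^+ r * qfactr q (2 * j + 1)
       / (qfact q r * qfactr q (2 * j + r%:R + 1)))%:C *:
    (Jminus12 q j1 j2 ^+ Num.truncn (r%:R + j - m) *m Jplus12 q j1 j2 ^+ r).

Definition vnorm n (v : 'cV[R[i]]_n) : R[i] :=
  sqrtC (\sum_i `|v i 0| ^+ 2).

(* The unit vector |j1, j2 : j m>. *)
Definition coupled q j1 j2 j m : 'cV[R[i]]_(dim j1 * dim j2) :=
  let v := proj q j1 j2 j m *m ket12 j1 j1 j2 (j - j1) in
  (vnorm v)^-1 *: v.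

(* <j1 m1, j2 m2 | j m>_q: as the |j1 m1>|j2 m2> are the standard basis,
   multiplying by the transpose of one of them reads off a coordinate. *)
Definition CG q j1 m1 j2 m2 j m : R[i] :=
  ((ket12 j1 m1 j2 m2)^T *m coupled q j1 j2 j m) 0 0.

Lemma Jplus12_nilpotent q j1 j2 r :
  (dim j1 * dim j2 <= r)%N -> Jplus12 q j1 j2 ^+ r = 0.
Proof.
pose ht (i : 'I_(dim j1 * dim j2)) :=
  ((mxtens_unindex i).1 + (mxtens_unindex i).2)%N.
have ketS j (i k : 'I_(dim j)) :
    ket j (mag k + 1) i 0 = ((i : nat) == k.+1)%:R.
  rewrite mxE /mag addrAC (inj_eq (addIr _)).
  by rewrite [X in _ == X]natr1 eqr_nat.
have step i k : ht i != (ht k).+1 -> Jplus12 q j1 j2 i k = 0.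
  rewrite /ht; case: (mxtens_indexP i) => a b.
  case: (mxtens_indexP k) => c d; rewrite !mxtens_indexK /=.
  rewrite /Jplus12 mxE !tensmxE !mxE -/(ket _ _ _ _) => h.
  move: (ketS _ a c) (ketS _ b d); rewrite !mxE => -> ->.
  have [E|_] := eqVneq (a : nat) c.+1.
    have [F|_] := eqVneq b d; first by rewrite E F addSn eqxx in h.
    have [F|_] := eqVneq (b : nat) d.+1; last first.
      by rewrite !(mulr0n, mulr0, addr0).
    rewrite mulr0n mulr0 add0r.
    case: eqVneq => [F'|]; last by rewrite !(mulr0n, mul0r).
    by move: E => /eqP; rewrite F' eqn_leq ltnn andbF.
  rewrite !(mulr0n, mulr0, mul0r) add0r.
  have [F|_] := eqVneq (b : nat) d.+1; last by rewrite !(mulr0n, mulr0).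
  have [F'|_] := eqVneq a c; last by rewrite !(mulr0n, mul0r).
  by rewrite F F' addnS eqxx in h.
have pow n i k : ht i != (ht k + n)%N -> (Jplus12 q j1 j2 ^+ n) i k = 0.
  elim: n i k => [|n IH] i k.
    rewrite addn0 expr0 mxE; case: (eqVneq i k) => [->|//].
    by rewrite eqxx.
  move=> h; rewrite exprS mxE big1 // => l _.
  have [E|/step ->] := eqVneq (ht i) (ht l).+1; last by rewrite mul0r.
  rewrite IH ?mulr0 //; apply: contraNneq h => F.
  by rewrite E F addnS.
move=> le_r; apply/matrixP => i k; rewrite pow ?mxE //.
apply: contraTneq le_r => E; rewrite -ltnNge.
apply: (@leq_ltn_trans (ht i)); first by rewrite E leq_addl.
rewrite /ht; case: (mxtens_unindex i) => a b /=.
have := leq_add (ltn_ord a : (a <= Num.truncn (2 * j1))%N)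
                (ltn_ord b : (b <= Num.truncn (2 * j2))%N).
move=> /leq_ltn_trans; apply; rewrite /dim mulSn mulnS addSn ltnS.
by rewrite addnA [X in (_ <= X + _)%N]addnC leq_addr.
Qed.

End CG.

(* Main.v *)
(* Let x be a vector of weight j with J_+(12) x = 0; the recursion expressing
   J_+(12) x = 0 on coordinates shows that x is unique up to a scalar and that
   its coordinates alternate in sign. The vector P^j_{jj} |j1 j1>|j2 j-j1> is
   such an x, and since P^j_{jj} acts as an orthogonal projection its coordinate
   at |j1 j1>|j2 j-j1> is its squared norm, so positive. This sign fixes x up to a
   positive factor, and |j1, j2 : j m> is J_-(12)^{j-m} x, normalized.

   The map |j1 m1>|j2 m2> -> |j2 -m2>|j1 -m1> exchanges J_-(12) and J_+(12), hence
   sends J_-(12)^{2j} x to a vector of weight j killed by J_+(12). Following the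
   coordinates at m1 = j1 while lowering, and then those at m2 = -j2, one sees
   that it satisfies the sign condition as well: this is the first equality.
   Exchanging the two factors turns J_+-(12) at q into J_+-(12) at 1/q, and the
   sign (-1)^(j1+j2-j) comes from the alternation of the coordinates of x. *)

Require Import Defs.
From mathcomp Require Import all_boot all_order all_algebra.
From mathcomp Require Import reals exp.
From mathcomp Require Import complex mxtens.
From mathcomp Require Import ring lra.

Set Implicit Arguments.
Unset Strict Implicit.
Unset Printing Implicit Defensive.

Import Order.TTheory GRing.Theory Num.Theory.

Local Open Scope ring_scope.

(* all_algebra also exports vector.dim. *)
Local Notation dim := Defs.dim.

(** * q-numbers *)

Section QNumbers.
Context {R : realType}.
Implicit Types q a b x y : R.

Lemma powRV_gt0 q x : 0 < q -> q^-1 `^ x = q `^ (- x).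
Proof. by move=> q0; rewrite -powR_inv1 ?ltW // -powRrM mulN1r. Qed.

Lemma qnum_inv q x : 0 < q -> qnum q^-1 x = qnum q x.
Proof.
move=> q0; rewrite /qnum !powRV_gt0 // opprK invrK.
by rewrite -opprB -[q^-1 - q]opprB invrN mulrNN.
Qed.

Lemma powRD_gt0 q x y : 0 < q -> q `^ (x + y) = q `^ x * q `^ y.
Proof. by move=> q0; rewrite powRD // (gt_eqF q0) implybT. Qed.

Lemma qnum0 q : qnum q 0 = 0.
Proof. by rewrite /qnum oppr0 subrr mul0r. Qed.

Lemma qdenom_neq0 q : 0 < q -> q != 1 -> q - q^-1 != 0.
Proof.
move=> q0 q1; rewrite subr_eq0; apply: contra q1 => /eqP h.
have: q ^+ 2 = 1 by rewrite expr2 {2}h mulfV ?gt_eqF.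
move/eqP; rewrite sqrf_eq1 => /orP[//|/eqP h']; lra.
Qed.

Lemma qnumD q x y : 0 < q ->
  qnum q (x + y) = q `^ y * qnum q x + q `^ (- x) * qnum q y.
Proof.
move=> q0; rewrite /qnum opprD !powRD_gt0 //.
ring.
Qed.

(** The q-analogue of a(b+1) - (a+1)b = a - b. It serves for the commutator on one spin ([amp_sqrB])
    and for the induction in [EFn]. *)
Lemma qnum_commutator q a b : 0 < q -> q != 1 ->
  qnum q a * qnum q (b + 1) - qnum q (a + 1) * qnum q b = qnum q (a - b).
Proof.
move=> q0 q1; have := qdenom_neq0 q0 q1; have := gt_eqF q0.
rewrite /qnum !opprD !powRD_gt0 //.
rewrite !powRN powRr1 ?ltW // => /negbT qn0 d0.
have p0 x : q `^ x != 0 by rewrite gt_eqF ?powR_gt0.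
field.
rewrite !p0 qn0 /= andbT.
apply/eqP => h; case/eqP: d0.
by apply: (mulfI qn0); rewrite mulr0 mulrBr mulfV // h.
Qed.

Lemma qnum_gt0 q x : 0 < q -> q != 1 -> 0 < x -> 0 < qnum q x.
Proof.
move=> q0; rewrite neq_lt => h x0.
wlog q1 : q q0 h / 1 < q.
  move=> W; case/orP: (h) => h'; last by apply: W.
  rewrite -qnum_inv //; apply: W; rewrite ?invr_gt0 //.
    by rewrite [_ < q^-1]invf_gt1 // h' orbT.
  by rewrite invf_gt1.
have qi : q^-1 < 1 by rewrite invf_lt1.
rewrite divr_gt0 ?subr_gt0 //; last exact: lt_trans q1.
rewrite powRN (@lt_trans _ _ 1) //.
  by rewrite invf_lt1 ?powR_gt0 // /powR gt_eqF // expR_gt1 mulr_gt0 // ln_gt0.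
by rewrite /powR gt_eqF // expR_gt1 mulr_gt0 // ln_gt0.
Qed.

Lemma qnum_ge0 q x : 0 < q -> q != 1 -> 0 <= x -> 0 <= qnum q x.
Proof.
move=> q0 q1; rewrite le_eqVlt => /orP[/eqP <-|/(qnum_gt0 q0 q1)/ltW //].
by rewrite qnum0.
Qed.

Lemma qfact_gt0 q n : 0 < q -> q != 1 -> 0 < qfact q n.
Proof.
move=> q0 q1; rewrite /qfact big_nat; apply: prodr_gt0 => k /andP[k0 _].
by rewrite qnum_gt0 // ltr0n.
Qed.

Lemma qfactS q n : qfact q n.+1 = qfact q n * qnum q n.+1%:R.
Proof. by rewrite /qfact big_nat_recr. Qed.

End QNumbers.

(** * Operators and coordinates *)

Section RealOperators.
Context {R : realType}.
Implicit Types q j m : R.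

Lemma spin_dim j : is_spin j -> (dim j)%:R = 2 * j + 1.
Proof. by case=> n ->; rewrite /dim mulrC divfK ?pnatr_eq0 // natrK -natr1. Qed.

Lemma mag_inj j : injective (@mag R j).
Proof. by move=> i k /addIr/eqP; rewrite eqr_nat => /eqP/val_inj. Qed.

Lemma mag_rev j (i : 'I_(dim j)) : is_spin j -> mag (rev_ord i) = - mag i.
Proof.
move=> sj; rewrite /mag /= natrB ?ltn_ord // -natr1 spin_dim //; ring.
Qed.

Lemma mag_bound j (i : 'I_(dim j)) : is_spin j -> - j <= mag i <= j.
Proof.
move=> sj; rewrite /mag lerDr ler0n /= lerBlDr.
have : (i.+1%:R : R) <= (dim j)%:R by rewrite ler_nat.
by rewrite spin_dim // -natr1 lerD2r mulr_natl mulr2n.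
Qed.

Lemma magP j k : is_spin j -> k%:R <= 2 * j ->
  exists i : 'I_(dim j), mag i = k%:R - j.
Proof.
move=> sj h; have kj : (k < dim j)%N.
  by rewrite -(ltr_nat R) spin_dim //; lra.
by exists (Ordinal kj).
Qed.

(** All matrices involved have real entries, so the work is done over [R]; the section
    [Complexification] transfers it to [R[i]]. *)
Definition rket j m : 'cV[R]_(dim j) := \col_i (mag i == m)%:R.

Definition amp q j m : R := Num.sqrt (qnum q (j + m) * qnum q (j - m + 1)).

Definition rJminus q j : 'M[R]_(dim j) :=
  \matrix_(i, k) (amp q j (mag k) * (mag i == mag k - 1)%:R).

Definition rqJ0 q (a : R) j : 'M[R]_(dim j) :=
  diag_mx (\row_k (q `^ (a * mag k))).

Lemma rqJ0_ket q (a : R) j m : rqJ0 q a j *m rket j m = q `^ (a * m) *: rket j m.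
Proof.
apply/matrixP => i k; rewrite mul_diag_mx !mxE.
by case: eqVneq => [->|_] //; rewrite !mulr0.
Qed.

(** Holds for every real m: the only m that is not a magnetic number while m - 1 is one is j + 1,
    where the amplitude vanishes. For [rJplus_ket] the critical value is -j - 1. *)
Lemma rJminus_ket q j m : is_spin j ->
  rJminus q j *m rket j m
  = amp q j m *: rket j (m - 1).
Proof.
move=> sj; apply/colP => i; rewrite !mxE.
case: (pickP [pred k : 'I_(dim j) | mag k == m]) => [k /= /eqP <-|hm].
  rewrite (bigD1 k) //= big1 ?addr0 => [|l lk]; rewrite !mxE.
    by rewrite eqxx mulr1.
  by rewrite (inj_eq (@mag_inj j)) (negbTE lk) mulr0.
rewrite big1 => [|l _]; last by have /= := hm l; rewrite !mxE => ->; rewrite mulr0.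
case: eqVneq => [E|_]; last by rewrite mulr0.
have [iN|iN] := ltnP i.+1 (dim j).
  have /= := hm (Ordinal iN); rewrite /mag /= -natr1.
  by rewrite addrAC -/(mag i) E subrK eqxx.
have {}iN : i.+1 = dim j by apply/eqP; rewrite eqn_leq iN ltn_ord.
have -> : m = j + 1.
  move: E (congr1 (GRing.natmul (1 : R)) iN).
  by rewrite spin_dim // -natr1 /mag => E1 E2; lra.
rewrite /amp (_ : j - _ + 1 = 0) ?qnum0; last by ring.
by rewrite mulr0 sqrtr0 mul0r.
Qed.

Lemma rJplus_ket q j m : is_spin j ->
  (rJminus q j)^T *m rket j m
  = amp q j (m + 1) *: rket j (m + 1).
Proof.
move=> sj; apply/colP => i; rewrite !mxE.
case: (pickP [pred k : 'I_(dim j) | mag k == m]) => [k /= /eqP <-|hm].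
  rewrite (bigD1 k) //= big1 ?addr0 => [|l lk]; rewrite !mxE.
    rewrite eqxx mulr1 eq_sym subr_eq.
    case: eqVneq => [->|_]; last by rewrite !mulr0.
    by rewrite !mulr1.
  by rewrite (inj_eq (@mag_inj j)) (negbTE lk) mulr0.
rewrite big1 => [|l _]; last by have /= := hm l; rewrite !mxE => ->; rewrite mulr0.
case: eqVneq => [E|_]; last by rewrite mulr0.
have [i0|i0] := posnP i.
  move: E; rewrite /mag i0 sub0r => E.
  have -> : m = - j - 1 by rewrite E addrK.
  rewrite /amp (_ : j + _ = 0) ?qnum0; last by ring.
  by rewrite mul0r sqrtr0 mul0r.
have iN : (i.-1 < dim j)%N by rewrite prednK // ltnW // ltn_ord.
have /= := hm (Ordinal iN); rewrite /mag /=.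
have := E; rewrite /mag -{1}(prednK i0) -natr1 => E'.
have -> : i.-1%:R - j = m by lra.
by rewrite eqxx.
Qed.

Lemma tensmxZ (k n p r : nat) (a b : R) (A : 'M[R]_(k, n)) (B : 'M[R]_(p, r)) :
  (a *: A) *t (b *: B) = (a * b) *: (A *t B).
Proof. by apply/matrixP => i l; rewrite !mxE mulrACA. Qed.

Definition rJminus12 q j1 j2 : 'M[R]_(dim j1 * dim j2) :=
  rJminus q j1 *t rqJ0 q 1 j2 + rqJ0 q (- 1) j1 *t rJminus q j2.

(** Taken as the transpose, so that adjointness to J_-(12) is immediate; [Jplus12_real] identifies
    it with J_+(12). *)
Definition rJplus12 q j1 j2 : 'M[R]_(dim j1 * dim j2) := (rJminus12 q j1 j2)^T.

Definition rket12 j1 m1 j2 m2 : 'cV[R]_(dim j1 * dim j2) :=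
  rket j1 m1 *t rket j2 m2.

(* [tensmx_mul] does not apply by rewriting, as the columns of a tensor product
   of two column vectors are indexed by 1 * 1. *)
Lemma tensmx_ket12 j1 m1 j2 m2 (A : 'M[R]_(dim j1)) (B : 'M[R]_(dim j2)) :
  (A *t B) *m rket12 j1 m1 j2 m2 = (A *m rket j1 m1) *t (B *m rket j2 m2).
Proof. exact: (tensmx_mul A B (rket j1 m1) (rket j2 m2)). Qed.

Lemma tr_rqJ0 q (a : R) j : (rqJ0 q a j)^T = rqJ0 q a j.
Proof. exact: tr_diag_mx. Qed.

Lemma rJminus12_ket q j1 j2 m1 m2 : is_spin j1 -> is_spin j2 ->
  rJminus12 q j1 j2 *m rket12 j1 m1 j2 m2 =
  (amp q j1 m1 * q `^ m2)
     *: rket12 j1 (m1 - 1) j2 m2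
  + (q `^ (- m1) * amp q j2 m2)
     *: rket12 j1 m1 j2 (m2 - 1).
Proof.
move=> s1 s2; rewrite /rJminus12 mulmxDl !tensmx_ket12.
by rewrite !rJminus_ket // !rqJ0_ket !tensmxZ mul1r mulN1r.
Qed.

Lemma rJplus12_ket q j1 j2 m1 m2 : is_spin j1 -> is_spin j2 ->
  rJplus12 q j1 j2 *m rket12 j1 m1 j2 m2 =
  (amp q j1 (m1 + 1) * q `^ m2)
     *: rket12 j1 (m1 + 1) j2 m2
  + (q `^ (- m1) * amp q j2 (m2 + 1))
     *: rket12 j1 m1 j2 (m2 + 1).
Proof.
move=> s1 s2; rewrite /rJplus12 /rJminus12 linearD /= !trmx_tens !tr_rqJ0.
rewrite mulmxDl !tensmx_ket12.
by rewrite !rJplus_ket // !rqJ0_ket !tensmxZ mul1r mulN1r.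
Qed.

(* Vanishes when m1 or m2 is not a magnetic number, so that [tcoef_rJminus12]
   and [tcoef_rJplus12] need no range conditions. *)
Definition tcoef j1 j2 (x : 'cV[R]_(dim j1 * dim j2)) m1 m2 : R :=
  ((rket12 j1 m1 j2 m2)^T *m x) 0 0.

(** * Coordinates in the product basis and squared norms *)

Section Coef.
Context {j1 j2 : R}.
Implicit Types x y : 'cV[R]_(dim j1 * dim j2).

Lemma tcoefD x y m1 m2 : tcoef (x + y) m1 m2 = tcoef x m1 m2 + tcoef y m1 m2.
Proof. by rewrite /tcoef mulmxDr mxE. Qed.

Lemma tcoefZ (c : R) x m1 m2 : tcoef (c *: x) m1 m2 = c * tcoef x m1 m2.
Proof. by rewrite /tcoef -scalemxAr mxE. Qed.

Lemma tcoef0 m1 m2 : tcoef (0 : 'cV[R]_(dim j1 * dim j2)) m1 m2 = 0.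
Proof. by rewrite /tcoef mulmx0 mxE. Qed.

Lemma tcoefB x y m1 m2 : tcoef (x - y) m1 m2 = tcoef x m1 m2 - tcoef y m1 m2.
Proof. by rewrite tcoefD -[- y]scaleN1r tcoefZ mulN1r. Qed.

Lemma tcoef_mag x a b : tcoef x (mag a) (mag b) = x (mxtens_index (a, b)) 0.
Proof.
rewrite /tcoef mxE (bigD1 (mxtens_index (a, b))) //= big1 ?addr0 => [|i].
  by rewrite !mxE !mxtens_indexK /= !eqxx !mul1r.
case: (mxtens_indexP i) => c d.
rewrite (can_eq (@mxtens_indexK _ _)) xpair_eqE negb_and !mxE !mxtens_indexK /=.
rewrite !(inj_eq (@mag_inj _)).
by case/orP=> /negbTE ->; rewrite !(mul0r, mulr0).
Qed.

Lemma tcoef_outl x m1 m2 : (forall a : 'I_(dim j1), mag a != m1) ->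
  tcoef x m1 m2 = 0.
Proof.
move=> h; rewrite /tcoef mxE big1 // => i _; case: (mxtens_indexP i) => c d.
by rewrite !mxE !mxtens_indexK /= (negbTE (h c)) !mul0r.
Qed.

Lemma tcoef_outr x m1 m2 : (forall a : 'I_(dim j2), mag a != m2) ->
  tcoef x m1 m2 = 0.
Proof.
move=> h; rewrite /tcoef mxE big1 // => i _; case: (mxtens_indexP i) => c d.
by rewrite !mxE !mxtens_indexK /= (negbTE (h d)) mulr0 mul0r.
Qed.

Variant tcoef_spec x m1 m2 : R -> Prop :=
  | CoefIn a b of m1 = mag a & m2 = mag b :
      tcoef_spec x m1 m2 (x (mxtens_index (a, b)) 0)
  | CoefOut of (forall a : 'I_(dim j1), mag a != m1)
            \/ (forall a : 'I_(dim j2), mag a != m2) : tcoef_spec x m1 m2 0.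

Lemma tcoefP x m1 m2 : tcoef_spec x m1 m2 (tcoef x m1 m2).
Proof.
case: (pickP [pred k : 'I_(dim j1) | mag k == m1]) => [a /= /eqP ha|h].
  case: (pickP [pred k : 'I_(dim j2) | mag k == m2]) => [b /= /eqP hb|h].
    by rewrite -ha -hb tcoef_mag; constructor.
  have {}h (b : 'I_(dim j2)) : mag b != m2 by have /= -> := h b.
  by rewrite tcoef_outr //; constructor; right.
have {}h (b : 'I_(dim j1)) : mag b != m1 by have /= -> := h b.
by rewrite tcoef_outl //; constructor; left.
Qed.

Lemma tcoef_ext x y : (forall m1 m2, tcoef x m1 m2 = tcoef y m1 m2) -> x = y.
Proof.
move=> h; apply/colP => i; case: (mxtens_indexP i) => a b.
by rewrite -!tcoef_mag.
Qed.

Hypotheses (s1 : is_spin j1) (s2 : is_spin j2).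

Lemma tcoef_range x m1 m2 : tcoef x m1 m2 != 0 ->
  (- j1 <= m1 <= j1) /\ (- j2 <= m2 <= j2).
Proof.
case: tcoefP => [a b -> -> _|]; last by rewrite eqxx.
by split; apply: mag_bound.
Qed.

Lemma tcoef_ket m1 m2 n1 n2 : tcoef (rket12 j1 m1 j2 m2) n1 n2 != 0 ->
  n1 = m1 /\ n2 = m2.
Proof.
case: tcoefP => [a b -> ->|]; last by rewrite eqxx.
rewrite !mxE !mxtens_indexK /=.
case: (mag a =P m1) => [->|_]; last by rewrite mul0r eqxx.
by case: (mag b =P m2) => [->|_]; last by rewrite mulr0 eqxx.
Qed.

Lemma tcoef_rJminus12 q x m1 m2 : tcoef (rJminus12 q j1 j2 *m x) m1 m2 =
  amp q j1 (m1 + 1) * q `^ m2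
     * tcoef x (m1 + 1) m2
  + q `^ (- m1) * amp q j2 (m2 + 1)
     * tcoef x m1 (m2 + 1).
Proof.
rewrite /tcoef mulmxA -[rJminus12 _ _ _]trmxK -trmx_mul rJplus12_ket //.
by rewrite linearD !linearZ /= mulmxDl -!scalemxAl !mxE.
Qed.

Lemma tcoef_rJplus12 q x m1 m2 : tcoef (rJplus12 q j1 j2 *m x) m1 m2 =
  amp q j1 m1 * q `^ m2
     * tcoef x (m1 - 1) m2
  + q `^ (- m1) * amp q j2 m2
     * tcoef x m1 (m2 - 1).
Proof.
rewrite /tcoef mulmxA -trmx_mul rJminus12_ket //.
by rewrite linearD !linearZ /= mulmxDl -!scalemxAl !mxE.
Qed.

Definition sqnorm x : R := \sum_i x i 0 ^+ 2.

Lemma sqnorm_tcoef x :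
  sqnorm x = \sum_(a < dim j1) \sum_(b < dim j2) tcoef x (mag a) (mag b) ^+ 2.
Proof.
rewrite pair_big /= /sqnorm (reindex (@mxtens_index _ _)) /=; last first.
  by exists (@mxtens_unindex _ _) => i _; rewrite ?mxtens_indexK ?mxtens_unindexK.
by apply: eq_bigr => -[a b] _; rewrite tcoef_mag.
Qed.

Lemma sqnorm_eq0 x : sqnorm x = 0 -> x = 0.
Proof.
move/eqP; rewrite psumr_eq0 => [|i _]; last exact: sqr_ge0.
move/allP => h; apply/colP => i; rewrite mxE; apply/eqP.
by have := h i (mem_index_enum _); rewrite sqrf_eq0.
Qed.

Lemma sqnorm_ge0 x : 0 <= sqnorm x.
Proof. by apply: sumr_ge0 => i _; apply: sqr_ge0. Qed.

Lemma sqnormE x : sqnorm x = (x^T *m x) 0 0.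
Proof. by rewrite mxE; apply: eq_bigr => i _; rewrite mxE. Qed.

Definition of_tcoef (f : R -> R -> R) : 'cV[R]_(dim j1 * dim j2) :=
  \col_i f (mag (mxtens_unindex i).1) (mag (mxtens_unindex i).2).

Lemma tcoef_of_tcoef f m1 m2 :
  ((forall a : 'I_(dim j1), mag a != m1)
    \/ (forall a : 'I_(dim j2), mag a != m2) -> f m1 m2 = 0) ->
  tcoef (of_tcoef f) m1 m2 = f m1 m2.
Proof.
by case: tcoefP => [a b -> ->|h ->//]; rewrite mxE mxtens_indexK.
Qed.

End Coef.
End RealOperators.

(** * Weights and commutators *)

Section Weights.
Context {R : realType} (q j1 j2 : R).
Hypotheses (q_gt0 : 0 < q) (q_neq1 : q != 1).
Hypotheses (s1 : is_spin j1) (s2 : is_spin j2).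
Implicit Types (mu m : R) (x y : 'cV[R]_(dim j1 * dim j2)).

Local Notation E := (rJplus12 q j1 j2).
Local Notation F := (rJminus12 q j1 j2).

(** Says that J_0(12) x = mu x, in terms of the support of the coordinates; zero has every
    weight. *)
Definition weight mu x : Prop :=
  forall m1 m2, tcoef x m1 m2 != 0 -> m1 + m2 = mu.

Lemma weightD mu x y : weight mu x -> weight mu y -> weight mu (x + y).
Proof.
move=> wx wy m1 m2; rewrite tcoefD.
have [->|/wx//] := eqVneq (tcoef x m1 m2) 0; rewrite add0r; exact: wy.
Qed.

Lemma weightZ mu a x : weight mu x -> weight mu (a *: x).
Proof.
move=> wx m1 m2; rewrite tcoefZ; have [->|/wx//] := eqVneq (tcoef x m1 m2) 0.
by rewrite mulr0 eqxx.
Qed.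

Lemma weight0 mu : weight mu 0.
Proof. by move=> m1 m2; rewrite tcoef0 eqxx. Qed.

Lemma weight_F mu x : weight mu x -> weight (mu - 1) (F *m x).
Proof.
move=> wx m1 m2; rewrite tcoef_rJminus12 //.
have [->|/wx] := eqVneq (tcoef x (m1 + 1) m2) 0; last by lra.
have [->|/wx] := eqVneq (tcoef x m1 (m2 + 1)) 0; last by lra.
by rewrite !mulr0 addr0 eqxx.
Qed.

Lemma weight_E mu x : weight mu x -> weight (mu + 1) (E *m x).
Proof.
move=> wx m1 m2; rewrite tcoef_rJplus12 //.
have [->|/wx] := eqVneq (tcoef x (m1 - 1) m2) 0; last by lra.
have [->|/wx] := eqVneq (tcoef x m1 (m2 - 1)) 0; last by lra.
by rewrite !mulr0 addr0 eqxx.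
Qed.

Lemma expmxS n (M : 'M[R]_n) k (x : 'cV[R]_n) :
  M ^+ k.+1 *m x = M *m (M ^+ k *m x).
Proof. by rewrite exprS mulmxA. Qed.

Lemma expmx0 n (M : 'M[R]_n) (x : 'cV[R]_n) : M ^+ 0 *m x = x.
Proof. by rewrite expr0 mul1mx. Qed.

Lemma weight_Fn mu k x : weight mu x -> weight (mu - k%:R) (F ^+ k *m x).
Proof.
move=> wx; elim: k => [|k IH]; first by rewrite expmx0 subr0.
rewrite expmxS -natr1 opprD addrA; exact: weight_F.
Qed.

Lemma weight_En mu k x : weight mu x -> weight (mu + k%:R) (E ^+ k *m x).
Proof.
move=> wx; elim: k => [|k IH]; first by rewrite expmx0 addr0.
rewrite expmxS -natr1 addrA; exact: weight_E.
Qed.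

Lemma sqr_amp j m : - j <= m <= j ->
  amp q j m ^+ 2 = qnum q (j + m) * qnum q (j - m + 1).
Proof.
move=> hm; rewrite sqr_sqrtr // mulr_ge0 // qnum_ge0 //; lra.
Qed.

Lemma sqr_ampS j m : - j <= m <= j ->
  amp q j (m + 1) ^+ 2 = qnum q (j + m + 1) * qnum q (j - m).
Proof.
move=> hm; rewrite /amp addrA (_ : j - _ + 1 = j - m); last by ring.
by rewrite sqr_sqrtr // mulr_ge0 // qnum_ge0 //; lra.
Qed.

Lemma amp_gt0 j m : - j < m <= j -> 0 < amp q j m.
Proof.
by move=> hm; rewrite sqrtr_gt0 mulr_gt0 // qnum_gt0 //; lra.
Qed.

(** The diagonal entry of [J_+, J_-] = [2 J_0]_q on a single spin. *)
Lemma amp_sqrB j m : - j <= m <= j ->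
  amp q j m ^+ 2 - amp q j (m + 1) ^+ 2 = qnum q (m + m).
Proof.
move=> hm; rewrite sqr_amp // sqr_ampS // qnum_commutator //.
by congr qnum; ring.
Qed.

Lemma powRS m : q `^ (m + 1) = q `^ m * q.
Proof. by rewrite powRD_gt0 // powRr1 // ltW. Qed.

Lemma powRP m : q `^ (m - 1) = q `^ m / q.
Proof. by rewrite powRD_gt0 // powR_inv1 // ltW. Qed.

(** The cross terms of the two products cancel; the diagonal ones leave q^(2 m2) [2 m1] + q^(-2 m1)
    [2 m2], which is [2 mu] by [qnumD]. *)
Lemma EF_commutator mu x : weight mu x ->
  E *m (F *m x) = F *m (E *m x) + qnum q (2 * mu) *: x.
Proof.
move=> wx; apply: tcoef_ext => m1 m2.
rewrite tcoefD tcoefZ !(tcoef_rJplus12, tcoef_rJminus12) //.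
rewrite !(subrK, addrK).
have qn0 : q != 0 by rewrite gt_eqF.
(* A nonzero coordinate puts m1 and m2 in the range where [amp_sqrB] holds; at a zero coordinate
   only the cross terms are left. *)
have [x0|x0] := eqVneq (tcoef x m1 m2) 0.
  rewrite x0 !opprD opprK !(powRS, powRP).
  by field.
have [h1 h2] := tcoef_range s1 s2 x0.
rewrite -(wx _ _ x0) (_ : 2 * (m1 + m2) = (m2 + m2) + (m1 + m1)); last by ring.
rewrite [_ + (m1 + m1)]addrC qnumD // -(amp_sqrB h1) -(amp_sqrB h2) !opprD.
rewrite !powRD_gt0 // !opprK powRr1 ?ltW // powR_inv1 ?ltW //.
by field.
Qed.

(** Moving J_+ past one J_- at a time adds [2(mu - i)] for i = 0, ..., k; by [qnum_commutator] these
    add up to [k+1][2 mu - k]. *)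
Lemma EFn mu k x : weight mu x ->
  E *m (F ^+ k.+1 *m x) = F ^+ k.+1 *m (E *m x)
    + (qnum q k.+1%:R * qnum q (2 * mu - k%:R)) *: (F ^+ k *m x).
Proof.
move=> wx; elim: k => [|k IH].
  rewrite expmx0 !expmxS !expmx0 (EF_commutator wx) subr0; congr (_ + _ *: _).
  suff -> : qnum q 1%:R = 1 by rewrite mul1r.
  by rewrite /qnum powRr1 ?ltW // powR_inv1 ?ltW // divff ?qdenom_neq0.
rewrite expmxS (EF_commutator (weight_Fn (k := k.+1) wx)) IH mulmxDr -expmxS.
rewrite -scalemxAr -expmxS -addrA -scalerDl; congr (_ + _ *: _).
have -> : 2 * (mu - k.+1%:R) = (2 * mu - k.+1%:R) - k.+1%:R by ring.
rewrite -(qnum_commutator _ k.+1%:R) // natr1 -(natr1 k).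
rewrite (_ : 2 * mu - (k%:R + 1) + 1 = 2 * mu - k%:R); last by ring.
ring.
Qed.

End Weights.

(** * Highest weight vectors *)

Section HighestWeight.
Context {R : realType} (q j1 j2 j : R).
Hypotheses (q_gt0 : 0 < q) (q_neq1 : q != 1).
Hypotheses (s1 : is_spin j1) (s2 : is_spin j2).
(* Equivalently 2 j1 = A + C, 2 j2 = B + C and 2 j = A + B. *)
Variables A B C : nat.
Hypotheses (AE : j + j1 - j2 = A%:R :> R) (BE : j - j1 + j2 = B%:R :> R).
Hypothesis (CE : j1 + j2 - j = C%:R :> R).
Implicit Types (m : R) (x y : 'cV[R]_(dim j1 * dim j2)).

Local Notation E := (rJplus12 q j1 j2).
Local Notation F := (rJminus12 q j1 j2).

(** The positivity fixes the sign and excludes zero, which satisfies the other two conditions. *)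
Definition highest_weight x : Prop :=
  [/\ E *m x = 0, weight j x & 0 < tcoef x j1 (j - j1)].

(** This is the coordinate of J_+(12) x = 0 at m1 = j1 - k, m2 = j - j1 + k + 1. *)
Lemma Eker_rec k x : E *m x = 0 ->
  amp q j1 (j1 - k%:R) * q `^ (j - j1 + k.+1%:R)
    * tcoef x (j1 - k.+1%:R) (j - j1 + k.+1%:R)
  = - (q `^ (k%:R - j1) * amp q j2 (j - j1 + k.+1%:R)
    * tcoef x (j1 - k%:R) (j - j1 + k%:R)).
Proof.
move=> Ex; have := tcoef_rJplus12 s1 s2 q x (j1 - k%:R) (j - j1 + k.+1%:R).
rewrite Ex tcoef0 -natr1 opprB.
rewrite (_ : j1 - k%:R - 1 = j1 - (k%:R + 1)); last by ring.
rewrite (_ : j - j1 + (k%:R + 1) - 1 = j - j1 + k%:R); last by ring.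
by move/esym/eqP; rewrite addr_eq0 => /eqP.
Qed.

(** As A + C = 2 j1, the bound on k means j1 - k > -j1; in [amp2_gt0], k < C means j - j1 + k + 1 <=
    j2. *)
Lemma amp1_gt0 k : (k < A + C)%N -> 0 < amp q j1 (j1 - k%:R).
Proof.
move: AE CE; rewrite -(ltr_nat R) natrD => ae ce h; apply: amp_gt0 => //.
have k0 := ler0n R k; apply/andP; split; lra.
Qed.

Lemma amp2_gt0 k : (k < C)%N -> 0 < amp q j2 (j - j1 + k.+1%:R).
Proof.
move: AE BE CE; rewrite -(ler_nat R) => ae be ce h; apply: amp_gt0 => //.
have k0 := ler0n R k; have B0 := ler0n R B; rewrite -natr1 in h *.
by apply/andP; split; lra.
Qed.

Lemma Eker_sign k x : E *m x = 0 -> 0 < tcoef x j1 (j - j1) -> (k <= C)%N ->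
  0 < (- 1) ^+ k * tcoef x (j1 - k%:R) (j - j1 + k%:R).
Proof.
move=> Ex x0; elim: k => [_|k IH kC]; first by rewrite mul1r subr0 addr0.
have kAC : (k < A + C)%N by rewrite ltn_addl.
have a1 := amp1_gt0 kAC; have a2 := amp2_gt0 kC.
have := Eker_rec k Ex; have {}IH := IH (ltnW kC).
set t := tcoef x (j1 - k%:R) _ in IH *; set t' := tcoef x _ _ => H.
have := mulr_gt0 (mulr_gt0 (powR_gt0 (k%:R - j1) q_gt0) a2) IH.
have -> : q `^ (k%:R - j1) * amp q j2 (j - j1 + k.+1%:R) * ((-1) ^+ k * t)
  = (amp q j1 (j1 - k%:R) * q `^ (j - j1 + k.+1%:R)) * ((-1) ^+ k.+1 * t').
  by rewrite [RHS]mulrCA H exprS; ring.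
by rewrite pmulr_rgt0 // mulr_gt0 // powR_gt0.
Qed.

Lemma Eker_eq0 x : E *m x = 0 -> weight j x -> tcoef x j1 (j - j1) = 0 -> x = 0.
Proof.
move=> Ex wx x0; apply: tcoef_ext => m1 m2; rewrite tcoef0.
apply/eqP; apply: contraT => xn0; have m12 := wx _ _ xn0.
suff H k : tcoef x (j1 - k%:R) (j - j1 + k%:R) = 0.
  move: xn0; case: tcoefP => [a b m1E m2E|]; last by rewrite eqxx.
  (* [rev_ord] counts the magnetic numbers downwards from j1. *)
  have aE : mag a = j1 - (rev_ord a)%:R.
    by rewrite -[in LHS](rev_ordK a) mag_rev // /mag opprB.
  rewrite -tcoef_mag -m2E aE (_ : m2 = j - j1 + (rev_ord a)%:R) ?H ?eqxx //.
  by rewrite -m12 m1E aE; ring.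
elim: k => [|k IH]; first by rewrite subr0 addr0.
have [kAC|kAC] := ltnP k (A + C).
  have := Eker_rec k Ex; rewrite IH mulr0 oppr0 => /eqP.
  by rewrite mulf_eq0 gt_eqF ?mulr_gt0 ?powR_gt0 ?amp1_gt0 // => /eqP.
(* For k >= A + C = 2 j1 the value j1 - (k + 1) lies below -j1. *)
apply/eqP; apply: contraT => /(tcoef_range s1 s2) [].
by move: AE CE kAC; rewrite -(ler_nat R) natrD -natr1; lra.
Qed.

Lemma highest_weight_unique x y : highest_weight x -> highest_weight y ->
  exists2 c, 0 < c & y = c *: x.
Proof.
move=> [Ex wx x0] [Ey wy y0].
exists (tcoef y j1 (j - j1) / tcoef x j1 (j - j1)); first exact: divr_gt0.
apply/eqP; rewrite -subr_eq0; apply/eqP; apply: Eker_eq0.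
- by rewrite mulmxBr Ey -scalemxAr Ex scaler0 subr0.
- by rewrite -scaleNr; apply: weightD => //; apply: weightZ.
- by rewrite tcoefB tcoefZ divfK ?subrr // gt_eqF.
Qed.

Lemma E_Fn x k : highest_weight x ->
  E *m (F ^+ k.+1 *m x)
  = (qnum q k.+1%:R * qnum q (2 * j - k%:R)) *: (F ^+ k *m x).
Proof.
by move=> [Ex wx _]; rewrite (EFn q_gt0 q_neq1 s1 s2 _ wx) Ex mulmx0 add0r.
Qed.

Lemma F_adjoint x y : (F *m x)^T *m y = x^T *m (E *m y).
Proof. by rewrite trmx_mul mulmxA. Qed.

(** By adjointness the squared norm is the pairing of F^(2j) x with E F^(2j+1) x, and the latter
    carries the factor [2j - 2j] = 0. *)
Lemma Fn_eq0 x : highest_weight x -> F ^+ (A + B).+1 *m x = 0.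
Proof.
move=> hx; apply: sqnorm_eq0; rewrite sqnormE {1}expmxS F_adjoint.
rewrite (E_Fn _ hx) (_ : 2 * j - _ = 0) ?qnum0 ?mulr0 ?scale0r ?mulmx0 ?mxE //.
by rewrite natrD -AE -BE; ring.
Qed.

(** Each raising undoes one lowering up to a factor [i][2j - i + 1] with 1 <= i <= 2j, which is
    positive. *)
Lemma En_Fn x n k : highest_weight x -> (k <= n <= A + B)%N ->
  exists2 c, 0 < c & E ^+ k *m (F ^+ n *m x) = c *: (F ^+ (n - k) *m x).
Proof.
move=> hx /andP[kn nAB]; elim: k kn => [|k IH] kn.
  by exists 1; rewrite ?expmx0 ?scale1r ?subn0.
have [c c0 Ec] := IH (ltnW kn).
rewrite expmxS Ec -scalemxAr -(subnSK kn) (E_Fn _ hx) scalerA.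
eexists; last by [].
rewrite mulr_gt0 // mulr_gt0 // qnum_gt0 // ?ltr0n //.
have : ((n - k.+1).+1%:R : R) <= (A + B)%:R.
  by rewrite ler_nat subnSK // (leq_trans (leq_subr _ _)).
by move: AE BE; rewrite natrD -natr1; lra.
Qed.

(** Along the edge m1 = j1 the term of J_-(12) coming from m1 = j1 + 1 has zero amplitude, so each
    coordinate is a positive multiple of the previous one. At k = B the corner m2 = -j2 is
    reached. *)
Lemma Fn_right_gt0 x k : highest_weight x -> (k <= B)%N ->
  0 < tcoef (F ^+ k *m x) j1 (j - j1 - k%:R).
Proof.
move=> [_ _ x0]; elim: k => [|k IH] kB; first by rewrite expmx0 subr0.
rewrite expmxS tcoef_rJminus12 //.
rewrite [amp q j1 (j1 + 1)]/amp (_ : j1 - _ + 1 = 0); last by ring.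
rewrite qnum0 mulr0 sqrtr0 !mul0r add0r.
rewrite (_ : j - j1 - k.+1%:R + 1 = j - j1 - k%:R); last by rewrite -natr1; ring.
rewrite mulr_gt0 ?IH 1?ltnW // mulr_gt0 ?powR_gt0 // amp_gt0 //.
move: kB; rewrite -(ler_nat R) -natr1 => kB.
move: BE CE => be ce.
have k0 := ler0n R k; have C0 := ler0n R C; apply/andP; split; lra.
Qed.

(** Along the edge m2 = -j2, lowering would mix in coordinates at m2 = -j2 + 1 of unknown sign.
    Raising has a single term there, so the sign is read from [E_Fn] instead, starting at the
    corner. *)
Lemma Fn_left_gt0 x l : highest_weight x -> (l <= A)%N ->
  0 < tcoef (F ^+ (B + l) *m x) (j1 - l%:R) (- j2).
Proof.
move=> hx; elim: l => [|l IH] lA.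
  rewrite addn0 subr0; have := Fn_right_gt0 hx (leqnn B).
  by rewrite -BE (_ : j - j1 - _ = - j2) //; ring.
have := IH (ltnW lA); set t := tcoef _ _ _ => t0.
have c0 : 0 < qnum q (B + l).+1%:R * qnum q (2 * j - (B + l)%:R).
  rewrite mulr_gt0 // qnum_gt0 ?ltr0n //.
  by move: AE BE lA; rewrite -(ler_nat R) natrD -natr1; lra.
have := mulr_gt0 c0 t0; rewrite -tcoefZ -(E_Fn _ hx) tcoef_rJplus12 //.
rewrite [amp q j2 _]/amp subrr qnum0 mul0r sqrtr0 !mulr0 mul0r addr0.
rewrite (_ : j1 - l%:R - 1 = j1 - l.+1%:R) ?addnS; last by rewrite -natr1; ring.
by rewrite pmulr_rgt0 // mulr_gt0 ?powR_gt0 // amp1_gt0 // ltn_addr.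
Qed.

(** Exchanging and negating the magnetic numbers makes this the coordinate that fixes the sign when
    j2 comes first. *)
Lemma F_lowest_gt0 x : highest_weight x ->
  0 < tcoef (F ^+ (A + B) *m x) (j2 - j) (- j2).
Proof.
move=> hx; have := Fn_left_gt0 hx (leqnn A).
by rewrite addnC -AE (_ : j1 - _ = j2 - j) //; ring.
Qed.

(* The coefficients solve the recursion [Eker_rec]. This vector only serves to
   show that [proj_top] below is nonzero. *)
Definition hwv_coeff k : R :=
  \prod_(i < k) - (q `^ (i%:R - j1) * amp q j2 (j - j1 + i.+1%:R)
                   / (amp q j1 (j1 - i%:R) * q `^ (j - j1 + i.+1%:R))).

Definition hwv : 'cV[R]_(dim j1 * dim j2) :=
  \sum_(k < C.+1) hwv_coeff k *: rket12 j1 (j1 - k%:R) j2 (j - j1 + k%:R).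

Lemma rket12_outr m1 m2 : j2 < m2 -> rket12 j1 m1 j2 m2 = 0.
Proof.
move=> h; apply/colP => i; rewrite !mxE mulrC; case: eqP => [E2|_].
  by have := mag_bound (mxtens_unindex i).2 s2; rewrite E2; lra.
by rewrite mul0r.
Qed.

Lemma E_hwv : E *m hwv = 0.
Proof.
(* J_+(12) sends the k-th summand to two terms; the choice of [hwv_coeff] makes the one raising m2
   cancel the one raising m1 in the next summand. *)
pose G k := (hwv_coeff k * (amp q j1 (j1 - k%:R + 1) * q `^ (j - j1 + k%:R)))
  *: rket12 j1 (j1 - k%:R + 1) j2 (j - j1 + k%:R).
have step k : (k <= C)%N ->
  E *m (hwv_coeff k *: rket12 j1 (j1 - k%:R) j2 (j - j1 + k%:R)) = G k - G k.+1.
  move=> kC; rewrite -scalemxAr rJplus12_ket // scalerDr !scalerA; congr (_ + _).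
  rewrite /G -natr1.
  rewrite (_ : j1 - (k%:R + 1) + 1 = j1 - k%:R); last by ring.
  rewrite (_ : j - j1 + (k%:R + 1) = j - j1 + k%:R + 1); last by ring.
  have [kC'|] := ltnP k C; last first.
    move=> Ck; have {kC Ck} -> : k = C by apply/eqP; rewrite eqn_leq kC.
    by rewrite rket12_outr ?scaler0 ?oppr0 // -CE; lra.
  rewrite -scaleNr; congr (_ *: _); rewrite /hwv_coeff big_ord_recr /= -natr1.
  rewrite opprB (_ : j - j1 + (k%:R + 1) = j - j1 + k%:R + 1); last by ring.
  have n1 : amp q j1 (j1 - k%:R) != 0 by rewrite gt_eqF // amp1_gt0 // ltn_addl.
  have n2 m : q `^ m != 0 by rewrite gt_eqF // powR_gt0.
  by field; rewrite n1 n2.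
rewrite /hwv mulmx_sumr (eq_bigr (fun k : 'I_C.+1 => G k - G k.+1)); last first.
  by move=> k _; rewrite step // -ltnS.
rewrite -(big_mkord xpredT (fun k => G k - G k.+1)).
under eq_bigr do rewrite -opprB.
(* Both ends vanish: G 0 because the amplitude at j1 + 1 is zero, G (C + 1) because its m2 exceeds
   j2. *)
rewrite sumrN telescope_sumr // opprB /G subr0.
rewrite [rket12 j1 _ j2 (_ + C.+1%:R)]rket12_outr.
  rewrite scaler0 subr0 /amp (_ : j1 - _ + 1 = 0); last by ring.
  by rewrite qnum0 mulr0 sqrtr0 mul0r mulr0 scale0r.
by rewrite -natr1 -CE; lra.
Qed.

End HighestWeight.

(** * The projection P^j *)

Section Projector.
Context {R : realType} (q j1 j2 j : R).
Hypotheses (q_gt0 : 0 < q) (q_neq1 : q != 1).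
Hypotheses (s1 : is_spin j1) (s2 : is_spin j2).
Variables A B C : nat.
Hypotheses (AE : j + j1 - j2 = A%:R :> R) (BE : j - j1 + j2 = B%:R :> R).
Hypothesis (CE : j1 + j2 - j = C%:R :> R).
Implicit Types (x y : 'cV[R]_(dim j1 * dim j2)).

Local Notation E := (rJplus12 q j1 j2).
Local Notation F := (rJminus12 q j1 j2).
Local Notation u := (rket12 j1 j1 j2 (j - j1)).

Lemma tcoef_ket_diag (a : 'I_(dim j1)) (b : 'I_(dim j2)) :
  tcoef (rket12 j1 (mag a) j2 (mag b)) (mag a) (mag b) = 1.
Proof. by rewrite tcoef_mag !mxE mxtens_indexK !eqxx mulr1. Qed.

Lemma tcoef_top : tcoef u j1 (j - j1) = 1.
Proof.
have [a aE] : exists a : 'I_(dim j1), mag a = (A + C)%:R - j1.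
  by apply: magP => //; rewrite natrD -AE -CE; lra.
have [b bE] : exists b : 'I_(dim j2), mag b = B%:R - j2.
  by apply: magP => //; have := ler0n R C; rewrite -BE -CE; lra.
have {}aE : mag a = j1 by rewrite aE natrD -AE -CE; ring.
have {}bE : mag b = j - j1 by rewrite bE -BE; ring.
by have := tcoef_ket_diag a b; rewrite aE bE.
Qed.

Lemma tcoef_sum n (f : 'I_n -> 'cV[R]_(dim j1 * dim j2)) m1 m2 :
  tcoef (\sum_k f k) m1 m2 = \sum_k tcoef (f k) m1 m2.
Proof. by rewrite /tcoef mulmx_sumr summxE. Qed.

Lemma tcoef_hwv : tcoef (hwv q j1 j2 j C) j1 (j - j1) = 1.
Proof.
rewrite /hwv tcoef_sum big_ord_recl big1 => [|k _].
  by rewrite tcoefZ /hwv_coeff big_ord0 mul1r subr0 !addr0 tcoef_top.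
rewrite tcoefZ; apply/eqP; rewrite mulf_eq0 orbC; apply/orP; left.
apply: contraT => /tcoef_ket[E1 _]; have := ltr0Sn R k.
by move: E1; rewrite lift0; lra.
Qed.

Definition proj_coeff r : R :=
  (- 1) ^+ r * qfactr q (2 * j + 1)
    / (qfact q r * qfactr q (2 * j + r%:R + 1)).

(** P^j_{jj} applied to |j1 j1>|j2 j-j1>; the square root in front of P^j_{mj} equals 1 for m =
    j. *)
Definition proj_top : 'cV[R]_(dim j1 * dim j2) :=
  \sum_(0 <= r < dim j1 * dim j2)
    proj_coeff r *: (F ^+ r *m (E ^+ r *m u)).

Lemma qfactrE (n : nat) (t : R) : t = n%:R -> qfactr q t = qfact q n.
Proof. by move=> ->; rewrite /qfactr natrK. Qed.

Lemma double_spin : 2 * j = (A + B)%:R.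
Proof. by rewrite natrD -AE -BE; ring. Qed.

Lemma proj_coeff0 : proj_coeff 0 = 1.
Proof.
rewrite /proj_coeff addr0 /qfact big_geq // !mul1r.
by rewrite divff // gt_eqF // qfact_gt0.
Qed.

(** The recursion that makes the sum in [E_proj_top] telescope. *)
Lemma proj_coeffS r :
  proj_coeff r.+1 * (qnum q r.+1%:R * qnum q (2 * j + r.+2%:R)) = - proj_coeff r.
Proof.
have n0 k : qfact q k != 0 by rewrite gt_eqF // qfact_gt0.
have b0 k : qnum q k.+1%:R != 0 by rewrite gt_eqF // qnum_gt0 // ltr0n.
rewrite /proj_coeff double_spin.
have eS k : qfactr q ((A + B)%:R + k%:R + 1) = qfact q (A + B + k).+1.
  by apply: qfactrE; rewrite -natr1 !natrD.
rewrite !eS; set a := qfactr _ _.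
rewrite addnS [qfact q (A + B + r).+2]qfactS [qfact q r.+1]qfactS -natrD !addnS.
have := n0 (A + B + r).+1; have := b0 (A + B + r).+1; have := b0 r; have := n0 r.
by rewrite exprS => h1 h2 h3 h4; field; rewrite h1 h2 h3 h4.
Qed.

Lemma weight_top : weight j u.
Proof. by move=> m1 m2 /tcoef_ket[-> ->]; ring. Qed.

Hypothesis E_nilpotent : E ^+ (dim j1 * dim j2) = 0.

Lemma E_proj_top : E *m proj_top = 0.
Proof.
rewrite /proj_top mulmx_sumr.
(* Since E^(n+1) u has weight j + n + 1, [EFn] produces [n+1][2j + n + 2], which [proj_coeffS]
   cancels against the remainder of the shorter sum. *)
have key n : \sum_(0 <= r < n.+1) E *m (proj_coeff r *: (F ^+ r *m (E ^+ r *m u)))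
    = proj_coeff n *: (F ^+ n *m (E ^+ n.+1 *m u)).
  elim: n => [|n IH].
    by rewrite big_nat1 -scalemxAr !expmx0 expmxS expmx0.
  rewrite big_nat_recr //= IH -scalemxAr.
  rewrite (EFn q_gt0 q_neq1 s1 s2 _ (weight_En s1 s2 (k := n.+1) weight_top)).
  rewrite -expmxS scalerDr scalerA addrCA -scalerDl -[RHS]addr0; congr (_ + _).
  rewrite (_ : 2 * (j + n.+1%:R) - n%:R = 2 * j + n.+2%:R).
    by rewrite proj_coeffS subrr scale0r.
  by rewrite -(natr1 n.+1) -(natr1 n); ring.
have {}key n : (0 < n)%N ->
    \sum_(0 <= r < n) E *m (proj_coeff r *: (F ^+ r *m (E ^+ r *m u)))
    = proj_coeff n.-1 *: (F ^+ n.-1 *m (E ^+ n *m u)) by case: n.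
by rewrite key // E_nilpotent mul0mx mulmx0 scaler0.
Qed.

(** The terms with r > 0 lie in the image of J_-(12), which is orthogonal to the kernel of its
    adjoint J_+(12). *)
Lemma proj_top_dot y : E *m y = 0 -> y^T *m proj_top = y^T *m u.
Proof.
move=> Ey; rewrite /proj_top mulmx_sumr big_ltn // big_nat.
rewrite big1 ?addr0 => [|[//|r] _]; first by rewrite !expmx0 proj_coeff0 scale1r.
rewrite -scalemxAr expmxS [y^T *m _]mulmxA.
have -> : y^T *m F = 0.
  by rewrite -[LHS]trmxK trmx_mul trmxK -/(rJplus12 q j1 j2) Ey trmx0.
by rewrite mul0mx scaler0.
Qed.

Lemma highest_weight_proj_top : highest_weight q j proj_top.
Proof.
(* [proj_top_dot] with y the projection itself: (Pu, Pu) = (Pu, u), the coordinate of Pu at u. *)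
have w_eq : tcoef proj_top j1 (j - j1) = sqnorm proj_top.
  rewrite sqnormE (proj_top_dot E_proj_top) /tcoef.
  by rewrite -[u^T *m _]trmxK trmx_mul trmxK mxE.
split; first exact: E_proj_top.
  rewrite /proj_top; elim/big_ind: _ => [|x y|r _]; first exact: weight0.
    exact: weightD.
  apply: weightZ; rewrite -[X in weight X](addrK r%:R).
  by apply: weight_Fn => //; apply: weight_En => //; apply: weight_top.
rewrite w_eq lt_def sqnorm_ge0 andbT; apply/eqP => /sqnorm_eq0 w0.
(* If the projection were zero, pairing it with [hwv] would make the top coordinate of [hwv] zero,
   but it is 1. *)
have := proj_top_dot (E_hwv q_gt0 q_neq1 s1 s2 AE CE).
rewrite w0 mulmx0 => /(congr1 (fun M : 'M_1 => M^T 0 0)).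
rewrite trmx_mul trmxK -/(tcoef _ _ _) tcoef_hwv trmx0 mxE => /esym/eqP.
by rewrite oner_eq0.
Qed.

End Projector.

(** * Clebsch-Gordan coefficients and their symmetries *)

Section Complexification.
Local Open Scope complex_scope.
Context {R : realType}.
Implicit Types (q j m : R).

Local Notation toC := (map_mx (real_complex R)).

Lemma Jminus_real q j : Jminus q j = toC (rJminus q j).
Proof. by apply/matrixP => i k; rewrite !mxE rmorphM /= rmorph_nat. Qed.

Lemma Jplus_real q j : Jplus q j = toC (rJminus q j)^T.
Proof.
apply/matrixP => i k; rewrite !mxE rmorphM /= rmorph_nat.
have -> : (mag k == mag i - 1) = (mag i == mag k + 1).
  by apply/eqP/eqP => ->; ring.
case: (mag i =P mag k + 1) => [->|_]; last by rewrite !mulr0.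
congr (_%:C * _); rewrite /amp mulrC; congr (Num.sqrt (qnum _ _ * qnum _ _)); ring.
Qed.

Lemma qJ0_real q (a : R) j : qJ0 q a j = toC (rqJ0 q a j).
Proof.
by rewrite map_diag_mx; congr diag_mx; apply/rowP => k; rewrite !mxE.
Qed.

Lemma ket12_real j1 m1 j2 m2 : ket12 j1 m1 j2 m2 = toC (rket12 j1 m1 j2 m2).
Proof. by apply/matrixP => i k; rewrite !mxE rmorphM /= !rmorph_nat. Qed.

Lemma Jminus12_real q j1 j2 : Jminus12 q j1 j2 = toC (rJminus12 q j1 j2).
Proof. by rewrite map_mxD !map_mxT -!Jminus_real -!qJ0_real. Qed.

Lemma Jplus12_real q j1 j2 : Jplus12 q j1 j2 = toC (rJplus12 q j1 j2).
Proof.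
rewrite /rJplus12 linearD /= !trmx_tens !tr_rqJ0 map_mxD !map_mxT.
by rewrite -!Jplus_real -!qJ0_real.
Qed.

Lemma toC_exp n (M : 'M[R]_n) k : toC (M ^+ k) = toC M ^+ k.
Proof.
elim: k => [|k IH]; first by rewrite !expr0 map_mx1.
by rewrite !exprS map_mxM IH.
Qed.

Lemma rJplus12_nilpotent q j1 j2 : rJplus12 q j1 j2 ^+ (dim j1 * dim j2) = 0.
Proof.
apply/eqP; rewrite -(map_mx_eq0 (real_complex R)) toC_exp -Jplus12_real.
by rewrite Jplus12_nilpotent.
Qed.

Lemma vnorm_real n (v : 'cV[R]_n) :
  vnorm (toC v) = (Num.sqrt (\sum_i v i 0 ^+ 2))%:C.
Proof.
have s0 : 0 <= \sum_i v i 0 ^+ 2 by apply: sumr_ge0 => i _; apply: sqr_ge0.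
rewrite /vnorm -[RHS]sqrCK ?ler0c ?sqrtr_ge0 // -rmorphXn /= sqr_sqrtr //.
rewrite rmorph_sum; congr sqrtC; apply: eq_bigr => i _ /=.
by rewrite mxE normc_def /= expr0n addr0 sqrtr_sqr -rmorphXn /= real_normK ?num_real.
Qed.

End Complexification.

(** * Clebsch-Gordan coefficients computed from any highest weight vector *)

Section CGFormula.
Local Open Scope complex_scope.
Context {R : realType} (q j1 j2 j : R).
Hypotheses (q_gt0 : 0 < q) (q_neq1 : q != 1).
Hypotheses (s1 : is_spin j1) (s2 : is_spin j2).
Variables A B C : nat.
Hypotheses (AE : j + j1 - j2 = A%:R :> R) (BE : j - j1 + j2 = B%:R :> R).
Hypothesis (CE : j1 + j2 - j = C%:R :> R).

Local Notation toC := (map_mx (real_complex R)).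
Local Notation F := (rJminus12 q j1 j2).

Lemma highest_weight_projection : highest_weight q j (proj_top q j1 j2 j).
Proof.
apply: (highest_weight_proj_top _ _ _ _ AE BE CE) => //.
exact: rJplus12_nilpotent.
Qed.

(** J_-(12)^(j-m) factors out of every summand on the left; s is the square root in front. *)
Lemma proj_ket12_real m n : j - m = n%:R ->
  exists2 s, 0 < s & proj q j1 j2 j m *m ket12 j1 j1 j2 (j - j1)
    = toC (s *: (F ^+ n *m proj_top q j1 j2 j)).
Proof.
move=> jm; eexists; last first.
  rewrite /proj -scalemxAl map_mxZ; congr (_ *: _).
  rewrite /proj_top mulmx_sumr mulmx_suml raddf_sum; apply: eq_bigr => r _ /=.
  rewrite -scalemxAl -scalemxAr map_mxZ; congr (_ *: _).
  rewrite -addrA jm -natrD natrK addnC exprD.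
  rewrite !map_mxM !toC_exp -Jminus12_real -Jplus12_real -ket12_real.
  by rewrite -[X in X *m _ *m _]/(_ *m _) -!mulmxA.
by rewrite sqrtr_gt0 divr_gt0 ?mulr_gt0 ?qfact_gt0.
Qed.

Lemma sqnormZ (a : R) (x : 'cV[R]_(dim j1 * dim j2)) :
  sqnorm (a *: x) = a ^+ 2 * sqnorm x.
Proof. by rewrite /sqnorm mulr_sumr; apply: eq_bigr => i _; rewrite mxE exprMn. Qed.

(** Another highest weight vector differs from the projection by a positive factor, which
    normalization removes. Each symmetry can thus use the vector that suits it. *)
Lemma CG_highest_weight (x : 'cV[R]_(dim j1 * dim j2)) m1 m2 m n :
  highest_weight q j x ->
  j - m = n%:R ->
  CG q j1 m1 j2 m2 j m =
    (tcoef (F ^+ n *m x) m1 m2 / Num.sqrt (sqnorm (F ^+ n *m x)))%:C.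
Proof.
move=> hx jm; have [s s0 pE] := proj_ket12_real jm.
have hw := highest_weight_projection.
have [a a0 wE] := highest_weight_unique q_gt0 q_neq1 s1 s2 AE CE hx hw.
set y := F ^+ n *m x; set t := s * a; have t0 : 0 < t by rewrite mulr_gt0.
rewrite wE -scalemxAr scalerA -/y -/t in pE; rewrite /CG /coupled pE.
rewrite vnorm_real -[\sum_i _]/(sqnorm (t *: y)) sqnormZ sqrtrM ?sqr_ge0 //.
rewrite sqrtr_sqr gtr0_norm // -fmorphV -map_mxZ ket12_real map_trmx -map_mxM mxE.
congr (_%:C); rewrite -/(tcoef _ m1 m2) !tcoefZ invfM mulrACA mulVf ?gt_eqF //.
by rewrite mul1r mulrC.
Qed.

End CGFormula.

(** * Exchange of the tensor factors, with and without negated magnetic numbers *)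

Section Symmetries.
Context {R : realType} (q j1 j2 : R).
Hypotheses (q_gt0 : 0 < q) (s1 : is_spin j1) (s2 : is_spin j2).
Implicit Types (m : R) (x : 'cV[R]_(dim j1 * dim j2)).

Definition flip x : 'cV[R]_(dim j2 * dim j1) :=
  of_tcoef (fun m1 m2 => tcoef x (- m2) (- m1)).

Definition swap x : 'cV[R]_(dim j2 * dim j1) :=
  of_tcoef (fun m1 m2 => tcoef x m2 m1).

Lemma magN_out j m : is_spin j -> (forall a : 'I_(dim j), mag a != m) ->
  forall a : 'I_(dim j), mag a != - m.
Proof.
by move=> sj h a; rewrite -eqr_oppLR -mag_rev // h.
Qed.

Lemma tcoef_flip x m1 m2 : tcoef (flip x) m1 m2 = tcoef x (- m2) (- m1).
Proof.
by apply: tcoef_of_tcoef => -[] /magN_out h;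
  [apply: tcoef_outr | apply: tcoef_outl]; apply: h.
Qed.

Lemma tcoef_swap x m1 m2 : tcoef (swap x) m1 m2 = tcoef x m2 m1.
Proof.
by apply: tcoef_of_tcoef => -[] h; [apply: tcoef_outr | apply: tcoef_outl].
Qed.

Lemma sqnorm_flip x : sqnorm (flip x) = sqnorm x.
Proof.
rewrite !sqnorm_tcoef exchange_big /= (reindex_inj rev_ord_inj) /=.
apply: eq_bigr => a _; rewrite (reindex_inj rev_ord_inj) /=.
by apply: eq_bigr => b _; rewrite tcoef_flip !mag_rev // !opprK.
Qed.

Lemma sqnorm_swap x : sqnorm (swap x) = sqnorm x.
Proof.
rewrite !sqnorm_tcoef exchange_big /=.
by apply: eq_bigr => a _; apply: eq_bigr => b _; rewrite tcoef_swap.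
Qed.

Lemma ampN j m : amp q j (- m + 1) = amp q j m.
Proof.
rewrite /amp mulrC; congr (Num.sqrt (qnum _ _ * qnum _ _)); ring.
Qed.

Lemma amp_inv j m : amp q^-1 j m = amp q j m.
Proof. by rewrite /amp !qnum_inv. Qed.

(** The exchange turns J_- (x) q^(J_0) into q^(J_0) (x) J_-, and the negation turns this into
    q^(-J_0) (x) J_+, so the base stays q. *)
Lemma flip_F x : flip (rJminus12 q j1 j2 *m x) = rJplus12 q j2 j1 *m flip x.
Proof.
apply: tcoef_ext => m1 m2; rewrite tcoef_flip tcoef_rJplus12 // !tcoef_flip.
rewrite tcoef_rJminus12 // !ampN !opprB opprK ![1 - _]addrC.
ring.
Qed.

Lemma flip_E x : flip (rJplus12 q j1 j2 *m x) = rJminus12 q j2 j1 *m flip x.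
Proof.
apply: tcoef_ext => m1 m2; rewrite tcoef_flip tcoef_rJminus12 // !tcoef_flip.
rewrite tcoef_rJplus12 // -[amp q j1 (- m2)]ampN -[amp q j2 (- m1)]ampN.
by rewrite !opprD !opprK; ring.
Qed.

(** The exchange interchanges the roles of q^(J_0) and q^(-J_0), which amounts to replacing q by
    1/q; the amplitudes are invariant under this. *)
Lemma swap_F x : swap (rJminus12 q j1 j2 *m x) = rJminus12 q^-1 j2 j1 *m swap x.
Proof.
apply: tcoef_ext => m1 m2; rewrite tcoef_swap !tcoef_rJminus12 // !tcoef_swap.
by rewrite !amp_inv !powRV_gt0 // opprK; ring.
Qed.

Lemma swap_E x : swap (rJplus12 q j1 j2 *m x) = rJplus12 q^-1 j2 j1 *m swap x.
Proof.
apply: tcoef_ext => m1 m2; rewrite tcoef_swap !tcoef_rJplus12 // !tcoef_swap.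
by rewrite !amp_inv !powRV_gt0 // opprK; ring.
Qed.

Lemma flip_En x n :
  flip (rJplus12 q j1 j2 ^+ n *m x) = rJminus12 q j2 j1 ^+ n *m flip x.
Proof. by elim: n => [|n IH]; rewrite ?expmx0 // !expmxS flip_E IH. Qed.

Lemma swap_Fn x n :
  swap (rJminus12 q j1 j2 ^+ n *m x) = rJminus12 q^-1 j2 j1 ^+ n *m swap x.
Proof. by elim: n => [|n IH]; rewrite ?expmx0 // !expmxS swap_F IH. Qed.

Lemma flip0 : flip 0 = 0.
Proof. by apply: tcoef_ext => m1 m2; rewrite tcoef_flip !tcoef0. Qed.

Lemma swap0 : swap 0 = 0.
Proof. by apply: tcoef_ext => m1 m2; rewrite tcoef_swap !tcoef0. Qed.

End Symmetries.

Lemma coupling_nats (R : realType) (j1 j2 j : R) :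
  is_spin j1 -> is_spin j2 -> in_steps `|j1 - j2| (j1 + j2) j ->
  exists A B C : nat, [/\ j + j1 - j2 = A%:R, j - j1 + j2 = B%:R
                        & j1 + j2 - j = C%:R].
Proof.
move=> [n1 ->] [n2 ->] [[k ->]].
(* Exchanging j1 and j2 exchanges A and B and keeps C. *)
wlog h : n1 n2 / (n2 <= n1)%N.
  move=> W; case/orP: (leq_total n2 n1) => h; first exact: W.
  rewrite distrC [X in _ <= X]addrC => /(W _ _ h)[A [B [C [AE BE CE]]]].
  by exists B, A, C; split; rewrite -?AE -?BE -?CE; ring.
have h' : (n2%:R : R) <= n1%:R by rewrite ler_nat.
rewrite ger0_norm; last by lra.
move=> kn; have kn2 : (k <= n2)%N by rewrite -(ler_nat R); lra.
(* Here j1 = n1/2, j2 = n2/2 and j = j1 - j2 + k. *)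
exists (n1 - n2 + k)%N, k, (n2 - k)%N.
by rewrite natrD !natrB //; split; field.
Qed.

Theorem mainTheorem3 (R : realType) (q j1 j2 j m1 m2 m : R)
    (hq : 0 < q < 1)
    (hj1 : is_spin j1) (hj2 : is_spin j2)
    (hj : in_steps `|j1 - j2| (j1 + j2) j)
    (hm1 : in_steps (- j1) j1 m1) (hm2 : in_steps (- j2) j2 m2)
    (hm : m = m1 + m2) (hmj : - j <= m <= j) :
  CG q j1 m1 j2 m2 j m = CG q j2 (- m2) j1 (- m1) j (- m) /\
  CG q j2 (- m2) j1 (- m1) j (- m) =
    (- 1) ^+ Num.truncn (j1 + j2 - j) * CG q^-1 j1 (- m1) j2 (- m2) j (- m).
Proof.
have [q_gt0 q_lt1] := andP hq; have q_neq1 : q != 1 by rewrite lt_eqF.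
have qV_gt0 : 0 < q^-1 by rewrite invr_gt0.
have qV_neq1 : q^-1 != 1 by rewrite invr_eq1.
have [A [B [C [AE BE CE]]]] := coupling_nats hj1 hj2 hj.
have AE' : j - j2 + j1 = A%:R by rewrite -AE; ring.
have BE' : j + j2 - j1 = B%:R by rewrite -BE; ring.
have CE' : j2 + j1 - j = C%:R by rewrite -CE; ring.
(* From weight j, n lowerings lead to m and 2j - n = A + B - n lead to -m. *)
have [n nE nAB] : exists2 n, j - m = n%:R & (n <= A + B)%N.
  have [[k1 k1E] _] := hm1; have [[k2 k2E] _] := hm2.
  have sE : j - m = (A + B + C)%:R - (k1 + k2)%:R.
    by rewrite hm k1E k2E !natrD -AE -BE -CE; ring.
  have k12 : (k1 + k2 <= A + B + C)%N by rewrite -(ler_nat R); lra.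
  exists (A + B + C - (k1 + k2))%N; first by rewrite natrB.
  by rewrite -(ler_nat R) natrB // -sE natrD -AE -BE; lra.
have n'E : j - - m = (A + B - n)%N%:R.
  by rewrite natrB // natrD -AE -BE -nE; ring.
have hx := highest_weight_projection q_gt0 q_neq1 hj1 hj2 AE BE CE.
set x := proj_top q j1 j2 j in hx.
(* The lowest vector F^(2j) x has weight -j and is killed by J_-(12); [flip] makes it a highest
   weight vector for j2, j1. *)
have hy : highest_weight q j (flip (rJminus12 q j1 j2 ^+ (A + B) *m x)).
  split.
  - rewrite -flip_F // -expmxS.
    by rewrite (Fn_eq0 q_gt0 q_neq1 hj1 hj2 AE BE hx) flip0.
  - have [_ wx _] := hx; move=> a b; rewrite tcoef_flip //.
    by move/(weight_Fn hj1 hj2 wx); rewrite natrD -AE -BE; lra.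
  - rewrite tcoef_flip // opprB.
    exact: (F_lowest_gt0 q_gt0 q_neq1 hj1 hj2 AE BE CE hx).
split.
  rewrite (CG_highest_weight q_gt0 q_neq1 hj1 hj2 AE BE CE _ _ hx nE).
  rewrite (CG_highest_weight q_gt0 q_neq1 hj2 hj1 BE' AE' CE' _ _ hy n'E).
  rewrite -flip_En //.
  (* Lowering the flipped vector 2j - n times is raising F^(2j) x as often, which gives back F^n x
     up to c > 0. *)
  have [|c c0 ->] := En_Fn q_gt0 q_neq1 hj1 hj2 AE BE hx
    (n := A + B) (k := A + B - n).
    by rewrite leq_subr leqnn.
  rewrite subKn // tcoef_flip // !opprK sqnorm_flip // tcoefZ sqnormZ.
  rewrite sqrtrM ?sqr_ge0 // sqrtr_sqr gtr0_norm // invfM mulrACA divff ?gt_eqF //.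
  by rewrite mul1r.
move: (flip _) hy => y [Ey wy y0].
(* The top coordinate of [swap y] is the coordinate of y at m1 = j2 - C, m2 = j1, of sign (-1)^C by
   [Eker_sign]; the factor makes it positive. *)
have hz : highest_weight q^-1 j ((- 1) ^+ C *: swap y).
  split.
  - by rewrite -scalemxAr -swap_E // Ey swap0 scaler0.
  - apply: weightZ => a b; rewrite tcoef_swap addrC; exact: wy.
  - rewrite tcoefZ tcoef_swap.
    have := Eker_sign q_gt0 q_neq1 hj2 hj1 BE' AE' CE' Ey y0 (leqnn C).
    rewrite -CE' (_ : j2 - _ = j - j1); last by ring.
    by rewrite (_ : j - j2 + _ = j1) //; ring.
have {}hy : highest_weight q j y by [].
have zE : rJminus12 q^-1 j1 j2 ^+ (A + B - n) *m ((- 1) ^+ C *: swap y)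
    = (- 1) ^+ C *: swap (rJminus12 q j2 j1 ^+ (A + B - n) *m y).
  by rewrite -scalemxAr swap_Fn.
have := CG_highest_weight qV_gt0 qV_neq1 hj1 hj2 AE BE CE (- m1) (- m2) hz n'E.
rewrite zE tcoefZ tcoef_swap sqnormZ sqnorm_swap sqrr_sign mul1r => ->.
rewrite (CG_highest_weight q_gt0 q_neq1 hj2 hj1 BE' AE' CE' _ _ hy n'E).
have sE : (- 1) ^+ C = ((- 1) ^+ C)%:C%C :> R[i]%C by rewrite rmorphXn rmorphN1.
by rewrite CE natrK sE -rmorphM !mulrA -[_ ^+ C * _]expr2 sqrr_sign mul1r.
Qed.
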